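(* Let $q=p^n$ with $p$ prime and let $f\in\mathbb{F}_q[x]$ be a polynomial of degree $k$ for some $0<k<q$. If $|D_f^{-1}D_f|<q-k+2$, then $f$ is a permutation of $\mathbb{F}_q$.
   Context: For $f\in\mathbb{F}_q[x]$ (viewed as a function $\mathbb{F}_q\to\mathbb{F}_q$), $D_f=\{(f(x)-f(y))/(x-y) : x,y\in\mathbb{F}_q,\ x\neq y\}$ is the set of directions determined by $f$. For $A,B\subseteq\mathbb{F}_q$: $A^{-1}=\{a^{-1} : a\in A\setminus\{0\}\}$ and $AB=\{ab : a\in A,\ b\in B\}$. *)

(* Defs.v *)
From mathcomp Require Import all_boot all_order all_algebra all_field.

Set Implicit Arguments.
Unset Strict Implicit.
Unset Printing Implicit Defensive.

Import GRing.Theory.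

Local Open Scope ring_scope.

Definition directions (F : finFieldType) (f : {poly F}) : {set F} :=
  [set (f.[xy.1] - f.[xy.2]) / (xy.1 - xy.2) | xy : F * F & xy.1 != xy.2].

(* Zero is removed first, since 0^-1 = 0 in the library. *)
Definition inv_set (F : finFieldType) (A : {set F}) : {set F} :=
  [set a^-1 | a in A :\ 0].

Definition mul_set (F : finFieldType) (A B : {set F}) : {set F} :=
  [set a * b | a in A, b in B].

(* Main.v *)
Require Import Defs.
From mathcomp Require Import all_boot all_order all_algebra all_field.
From mathcomp Require Import ring.

(* If [f] takes the same value at [a != b], then any [x] with [f x != f a]
   gives two nonzero directions, towards [a] and towards [b], whose quotient is
   [(x - b) / (x - a)].  At least [q - k] points [x] qualify, and these
   quotients are distinct and differ from [0] and [1], which also lie in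
   [D_f^-1 D_f]; hence [D_f^-1 D_f] has at least [q - k + 2] elements. *)

Set Implicit Arguments.
Unset Strict Implicit.
Unset Printing Implicit Defensive.

Import GRing.Theory.

Local Open Scope ring_scope.

Lemma mem_directions (F : finFieldType) (f : {poly F}) (x y : F) :
  x != y -> (f.[x] - f.[y]) / (x - y) \in directions f.
Proof. by move=> xy; apply/imsetP; exists (x, y) => //; rewrite inE. Qed.

Lemma mem_quotient_set (F : finFieldType) (D : {set F}) (d e : F) :
  d \in D -> e \in D -> d != 0 -> e / d \in mul_set (inv_set D) D.
Proof.
move=> Dd De d0; rewrite mulrC; apply: imset2_f => //.
by apply: imset_f; rewrite !inE d0.
Qed.

(** The level set consists of roots of [f - c%:P], which has the same size as the nonconstant [f]
    and so is nonzero. *)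
Lemma card_level_set (F : finFieldType) (f : {poly F}) (c : F) :
  (1 < size f)%N -> (#|[set x | f.[x] == c]| < size f)%N.
Proof.
move=> f_gt1.
have szg : size (f - c%:P) = size f.
  by rewrite size_polyDl // size_polyN (leq_ltn_trans (size_polyC_leq1 c)).
rewrite cardE -szg; apply: max_poly_roots; last exact: enum_uniq.
  by rewrite -size_poly_gt0 szg ltnW.
by apply/allP => x; rewrite mem_enum inE rootE !hornerE subr_eq0.
Qed.

(* In the form [1 + (a - b) / (x - a)] of [(x - b) / (x - a)], the junk value
   [0^-1 = 0] at [x = a] gives [1], so that [a] and [b] account for the two
   extra elements [1] and [0]. *)
Lemma card_quotient_directions (F : finFieldType) (f : {poly F}) (a b c : F) :
    a != b -> f.[a] = f.[b] -> f.[c] != f.[a] ->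
  (#|[set x | f.[x] != f.[a]]| + 2 <=
     #|mul_set (inv_set (directions f)) (directions f)|)%N.
Proof.
move=> ab fab fca; set S := [set x | _]; set M := mul_set _ _.
pose h x := 1 + (a - b) / (x - a).
have h_inj : injective h.
  move=> x y /addrI/(mulfI _) xy.
  (* With [0^-1 = 0], inversion is injective on all of [F], so [x = a] needs no separate case. *)
  by apply/(addIr (- a))/invr_inj/xy; rewrite subr_eq0.
have neq x y : f.[x] != f.[y] -> x != y by apply: contraNneq => ->.
have dir_neq0 x y : f.[x] != f.[y] -> (f.[x] - f.[y]) / (x - y) != 0.
  by move=> fxy; rewrite mulf_neq0 ?invr_eq0 ?subr_eq0 // neq.
have mem_M x y d : f.[x] != f.[y] -> d \in directions f ->
    d / ((f.[x] - f.[y]) / (x - y)) \in M.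
  move=> fxy Dd; apply: mem_quotient_set Dd (dir_neq0 _ _ fxy).
  exact/mem_directions/neq.
have hM x : x \in a |: (b |: S) -> h x \in M.
  rewrite !inE => /or3P[/eqP->|/eqP->|fxa].
  - rewrite /h subrr invr0 mulr0 addr0 -(divff (dir_neq0 _ _ fca)).
    exact: (mem_M _ _ _ fca (mem_directions _ (neq _ _ fca))).
  - rewrite /h -opprB mulNr divff ?subr_eq0 1?eq_sym // subrr.
    rewrite -(mul0r (((f.[c] - f.[a]) / (c - a))^-1)).
    apply: mem_M => //.
    (* [0] is the direction of the pair [a], [b]. *)
    by rewrite -(mul0r (a - b)^-1) -(subrr f.[a]) {2}fab; apply: mem_directions.
  - have fxb : f.[x] != f.[b] by rewrite -fab.
    (* Since [f.[a] = f.[b]], the two numerators cancel. *)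
    suff -> : h x = (f.[x] - f.[a]) / (x - a) / ((f.[x] - f.[b]) / (x - b)).
      exact: (mem_M _ _ _ fxb (mem_directions _ (neq _ _ fxa))).
    rewrite -fab /h; field.
    by rewrite !subr_eq0 fxa (neq _ _ fxa) (neq _ _ fxb).
have -> : (#|S| + 2 = #|h @: (a |: (b |: S))|)%N.
  by rewrite (card_imset _ h_inj) !cardsU1 !inE -fab eqxx (negbTE ab) !addnA addnC.
by apply/subset_leq_card/subsetP => _ /imsetP[x Sx ->]; apply: hM.
Qed.

Theorem theorem2 (p n q : nat) (hp : prime p) (hq : q = (p ^ n)%N)
    (F : finFieldType) (hF : #|F| = q)
    (f : {poly F}) (k : nat) (hdeg : size f = k.+1) (hk : (0 < k < q)%N)
    (hD : (#|mul_set (inv_set (directions f)) (directions f)| < q - k + 2)%N) :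
  bijective (fun x : F => f.[x]).
Proof.
apply: injF_bij => a b /= fab; apply/eqP; apply: contraTT hD => ab.
case/andP: hk => k_gt0 k_ltq.
have level : (#|[set x | f.[x] == f.[a]]| <= k)%N.
  by rewrite -ltnS -hdeg card_level_set // hdeg.
have S_ge : (q - k <= #|[set x | f.[x] != f.[a]]|)%N.
  rewrite -hF -(cardsC [set x | f.[x] == f.[a]]) leq_subLR.
  rewrite leq_add //; apply: eq_leq; apply: eq_card => x.
  by rewrite !inE.
(* As [k < q], some [c] lies off the level set; it supplies the nonzero denominator used to obtain
   [1] and [0]. *)
have /card_gt0P[c] : (0 < #|[set x | f.[x] != f.[a]]|)%N.
  by rewrite (leq_trans _ S_ge) // subn_gt0.
rewrite inE -leqNgt => fca.
by apply: leq_trans (card_quotient_directions ab fab fca); rewrite leq_add2r.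
Qed.
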